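(* Suppose $\Phi\in\mathbb{C}^{d\times n}$ is a complex ETF with entries in $\mathcal{O}_E$, where $E\subset\mathbb{C}$ is a number field that is Galois over $\mathbb{Q}$ and $\mathcal{O}_E$ is its ring of algebraic integers. Then, for infinitely many pairwise coprime prime powers $q$, there exists a $\ast$-ring homomorphism $f\colon\mathcal{O}_E\to\mathbb{F}_{q^2}$ such that the matrix $f(\Phi)\in\mathbb{F}_{q^2}^{d\times n}$, obtained by applying $f$ entrywise, is a $d\times n$ ETF in the complex model.
   Context: A $d\times n$ complex ETF (equiangular tight frame) is a matrix $\Phi=[\varphi_1\ \cdots\ \varphi_n]\in\mathbb{C}^{d\times n}$ with $\Phi\Phi^*=cI$ for some $c>0$, whose columns are equal-norm nonzero vectors spanning equiangular lines: there is $b\in[0,1)$ such that the unit-norm rescalings $\psi_j$ of $\varphi_j$ satisfy $|\langle\psi_i,\psi_j\rangle|^2=b$ for all $i\ne j$. A $\ast$-ring is a ring with an involutory ring automorphism; a $\ast$-ring homomorphism is a ring homomorphism preserving the involutions. Here $\mathcal{O}_E$ carries complex conjugation (it is closed under it because $E$ is Galois) and $\mathbb{F}_{q^2}$ carries $x\mapsto x^q$, so the condition is $f(\overline{x})=f(x)^q$ for all $x\in\mathcal{O}_E$. Complex model: $\mathbb{F}_{q^2}^d$ with the form $(x,y)=\sum_i x_i^qy_i$; for a matrix $A=[a_{ij}]$ over $\mathbb{F}_{q^2}$, $A^*=[a_{ji}^q]$. A matrix $\Psi\in\mathbb{F}_{q^2}^{d\times n}$ with columns $\psi_1,\dots,\psi_n$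 is an ETF in the complex model if its columns span $\mathbb{F}_{q^2}^d$ and for some $a,b,c\in\mathbb{F}_q$: $(\psi_j,\psi_j)=a$ for all $j$, $(\psi_i,\psi_j)(\psi_j,\psi_i)=b$ for all $i\ne j$, and $\Psi\Psi^*=cI$. *)

(* Defs.v *)
From HB Require Import structures.
From mathcomp Require Import all_boot all_order all_algebra all_field.
From mathcomp Require Import boolp reals.
From mathcomp Require Import complex.

Set Implicit Arguments.
Unset Strict Implicit.
Unset Printing Implicit Defensive.

Import Order.TTheory GRing.Theory Num.Theory.
Local Open Scope ring_scope.

Definition prime_power (q : nat) : Prop :=
  exists p k : nat, [/\ prime p, (0 < k)%N & q = (p ^ k)%N].

(* The form is antilinear in its first argument. *)
Definition star_dot (K : pzRingType) (s : K -> K) d (u v : 'cV[K]_d) : K :=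
  \sum_(k < d) s (u k 0) * v k 0.

Definition star_adj (K : pzRingType) (s : K -> K) m n (A : 'M[K]_(m, n)) :
  'M[K]_(n, m) := (map_mx s A)^T.

Definition star_preserving (A B : Type) (sA : A -> A) (sB : B -> B)
  (f : A -> B) : Prop := forall x, f (sA x) = sB (f x).

Section ComplexETF.
Variables (R : realType) (d n : nat).
Local Notation C := (R[i]%C).

Definition cnorm (u : 'cV[C]_d) : C := sqrtC (star_dot Num.conj u u).

Definition unit_rescaling (u : 'cV[C]_d) : 'cV[C]_d := (cnorm u)^-1 *: u.

Definition complex_etf (Phi : 'M[C]_(d, n)) : Prop :=
  let psi j := unit_rescaling (col j Phi) in
  [/\ exists2 c : R, 0 < c & Phi *m star_adj Num.conj Phi = (c%:C)%C%:M,
      forall j, col j Phi != 0,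
      forall i j, cnorm (col i Phi) = cnorm (col j Phi)
    & exists2 b : R, 0 <= b < 1 &
        forall i j, i != j -> `|star_dot Num.conj (psi i) (psi j)| ^+ 2 = b%:C%C].

End ComplexETF.

Section FiniteETF.
Variables (F : finFieldType) (q d n : nat).

(* The involution of F_(q^2), meaningful when #|F| = q ^ 2. *)
Definition qpow (x : F) : F := x ^+ q.

(* The subfield F_q of F_(q^2) is the set of fixed points of qpow. *)
Definition in_Fq (x : F) : Prop := qpow x = x.

Definition finite_etf (Psi : 'M[F]_(d, n)) : Prop :=
  let psi j := col j Psi in
  <<[seq psi j | j : 'I_n]>>%VS = fullv /\
  exists a b c : F,
    [/\ [/\ in_Fq a, in_Fq b & in_Fq c],
        forall j, star_dot qpow (psi j) (psi j) = a,
        forall i j, i != j ->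
          star_dot qpow (psi i) (psi j) * star_dot qpow (psi j) (psi i) = b
      & Psi *m star_adj qpow Psi = c%:M].

End FiniteETF.

Section RingOfIntegers.
Variable E : fieldExtType rat.

Definition alg_integer : {pred E} :=
  fun x => `[< integralOver (intr : int -> E) x >].

Lemma alg_integerP x :
  reflect (integralOver (intr : int -> E) x) (x \in alg_integer).
Proof. exact: asboolP. Qed.

Lemma alg_integer_subring : subring_closed alg_integer.
Proof.
split=> [|x y /alg_integerP hx /alg_integerP hy|x y /alg_integerP hx /alg_integerP hy];
  apply/alg_integerP.
- exact: integral1.
- exact: integral_sub.
- exact: integral_mul.
Qed.

HB.instance Definition _ :=
  GRing.isSubringClosed.Build E alg_integer alg_integer_subring.

Record int_ring : predArgType :=
  IntRing { int_val : E; int_valP : int_val \in alg_integer }.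

HB.instance Definition _ := [isSub for int_val].
HB.instance Definition _ := [Choice of int_ring by <:].
HB.instance Definition _ := [SubChoice_isSubComNzRing of int_ring by <:].

End RingOfIntegers.

(* Complex conjugation on a normal extension E of Q embedded in C by iota. *)
Section Conjugation.
Variables (C : numClosedFieldType) (E : splittingFieldType rat).
Variable iota : {rmorphism E -> C}.

Lemma field_conj_ex (x : E) : exists y : E, iota y == (iota x)^*.
Proof.
have [r /eqP Dp] := splitting_field_normal 1%AS x.
set p := minPoly 1 x in Dp.
have conj_p : map_poly Num.conj (map_poly iota p) = map_poly iota p.
  apply/polyP=> i; rewrite !coef_map /=.
  have /vlineP[a ->] : p`_i \in 1%VS by apply/polyOverP/minPolyOver.
  have -> : iota (a *: 1) = ratr a by exact: (fmorph_eq_rat (iota \o in_alg E)).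
  exact: fmorph_rat.
have : root (map_poly iota p) (iota x)^*.
  by rewrite -conj_p !fmorph_root root_minPoly.
rewrite Dp rmorph_prod /= => hr.
have : root (\prod_(z <- [seq iota y | y <- r]) ('X - z%:P)) (iota x)^*.
  rewrite big_map; congr (is_true (root _ _)): hr.
  by apply: eq_bigr => y _; rewrite rmorphB /= map_polyX map_polyC.
by rewrite root_prod_XsubC => /mapP[y _ ->]; exists y.
Qed.

Definition field_conj (x : E) : E := xchoose (field_conj_ex x).

Lemma field_conjE x : iota (field_conj x) = (iota x)^*.
Proof. exact/eqP/(xchooseP (field_conj_ex x)). Qed.

Lemma field_conj_integer x :
  x \in @alg_integer E -> field_conj x \in @alg_integer E.
Proof.
move=> /alg_integerP[p mon_p px0]; apply/alg_integerP; exists p => //.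
have hp : map_poly iota (map_poly intr p) = map_poly intr p.
  by rewrite -map_poly_comp; apply: eq_map_poly => z /=; rewrite rmorph_int.
rewrite -(fmorph_root iota) hp field_conjE.
have <- : map_poly Num.conj (map_poly intr p) = map_poly intr p :> {poly C}.
  by rewrite -map_poly_comp; apply: eq_map_poly => z /=; rewrite rmorph_int.
by rewrite fmorph_root -hp fmorph_root.
Qed.

Definition int_conj (x : int_ring E) : int_ring E :=
  IntRing (field_conj_integer (int_valP x)).

Definition int_embed (x : int_ring E) : C := iota (int_val x).

Lemma int_conjE x : int_embed (int_conj x) = (int_embed x)^*.
Proof. exact: field_conjE. Qed.

Lemma int_embed_inj : injective int_embed.
Proof. by move=> x y /fmorph_inj/val_inj. Qed.

Lemma int_conjK : involutive int_conj.
Proof. by move=> x; apply: int_embed_inj; rewrite !int_conjE conjCK. Qed.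

Lemma int_conj_zmod : zmod_morphism int_conj.
Proof.
move=> x y; apply: int_embed_inj; rewrite int_conjE /int_embed !rmorphB /=.
by rewrite !field_conjE.
Qed.

Lemma int_conj_monoid : monoid_morphism int_conj.
Proof.
split=> [|x y]; apply: int_embed_inj; rewrite int_conjE /int_embed.
  by rewrite !rmorph1.
by rewrite !rmorphM /= !field_conjE.
Qed.

HB.instance Definition _ :=
  GRing.isZmodMorphism.Build (int_ring E) (int_ring E) int_conj int_conj_zmod.
HB.instance Definition _ :=
  GRing.isMonoidMorphism.Build (int_ring E) (int_ring E) int_conj
    int_conj_monoid.

End Conjugation.

(* Main.v *)
From HB Require Import structures.
Require Import Defs.
From mathcomp Require Import all_boot all_order all_fingroup all_algebra all_field.
From mathcomp Require Import boolp classical_sets cardinality reals.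
From mathcomp Require Import polyorder polyrcf complex.
From mathcomp Require Import zify ring lra.

Set Implicit Arguments.
Unset Strict Implicit.
Unset Printing Implicit Defensive.

Import Order.TTheory GRing.Theory Num.Theory.
Local Open Scope ring_scope.

(* Take for q primes p = 3 mod 4. Write E = Q(z) and let eta be a real number
   generating the field of the real and imaginary parts of z. Some D != 0
   satisfies D * O_E <= Z[eta] + i Z[eta] inside C. Let G be the primitive
   minimal polynomial of eta over Z. If p = 3 mod 4 does not divide D and G has
   a root t mod p, then eta |-> t and i |-> w, with w ^ 2 = -1 in F_(p^2), define
   a ring homomorphism on O_E; it intertwines complex conjugation with x |-> x ^ p
   because t ^ p = t and w ^ p = - w.

   Such primes are found by Nagell's argument: G changes sign at its simple real
   root eta, so some rational x / y near eta with x = 1 and y = 0 modulo 4P makes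
   y ^ deg(G) G(x / y) / lead_coef(G) a negative integer which is 1 mod 4P. Its
   absolute value is 3 mod 4, hence has a prime factor p = 3 mod 4 prime to P,
   and x / y is a root of G mod p.

   A homomorphism compatible with the involutions preserves all Gram identities;
   the columns still span as soon as p does not divide the norm of the frame
   constant. *)

(** * Primes 3 modulo 4 with a root *)

(** Residues mod 4 multiply: if the least prime factor is not 3 mod 4, then the cofactor is, and the
    induction continues with it. *)
Lemma prime_divisor_3mod4 n :
  (n %% 4 = 3)%N -> exists p, [/\ prime p, (p %% 4 = 3)%N & (p %| n)%N].
Proof.
have [m] := ubnP n; elim: m n => // m IHm n lenm n3.
have n_gt1 : (1 < n)%N by lia.
have p_pr := pdiv_prime n_gt1; set p := pdiv n in p_pr.
have Dn : n = (n %/ p * p)%N by rewrite divnK ?pdiv_dvd.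
have p_gt1 := prime_gt1 p_pr.
have [p3 | p3] := eqVneq (p %% 4)%N 3.
  by exists p; split; rewrite ?pdiv_dvd.
have n'3 : (n %/ p %% 4 = 3)%N.
  have: ((n %/ p %% 4) * (p %% 4) %% 4 = 3)%N by rewrite modnMm -Dn.
  have : (n %/ p %% 4 < 4)%N by rewrite ltn_mod.
  have : (p %% 4 < 4)%N by rewrite ltn_mod.
  move: (n %/ p %% 4)%N (p %% 4)%N p3 => a b.
  by case: a => [|[|[|[|]]]] //; case: b => [|[|[|[|]]]].
have [|r [r_pr r3 r_dv]] := IHm (n %/ p)%N _ n'3.
  have : (n %/ p < n)%N by rewrite ltn_Pdiv // ltnW.
  lia.
by exists r; split=> //; rewrite Dn dvdn_mulr.
Qed.

Section SignChange.
Variable R : rcfType.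

(** Factor [G] as [Q * ('X - eta%:P)]. Simplicity gives [Q.[eta] != 0], so [L * G] changes sign at
    [eta]; the interval lies on the side where it is negative. *)
Lemma simple_root_sign_change (G : {poly R}) (eta L : R) :
    root G eta -> ~~ root G^`() eta -> L != 0 ->
  exists2 I : R * R, I.1 < I.2 & forall x, I.1 < x < I.2 -> L * G.[x] < 0.
Proof.
move=> /factor_theorem[Q ->]; rewrite derivM derivXsubC mulr1 rootE.
rewrite hornerD !hornerM !hornerXsubC subrr mulr0 add0r => Qeta nzL.
have [|d d_gt0 Qd] := @poly_cont R eta Q `|Q.[eta]|; first by rewrite normr_gt0.
have Qpos x : `|x - eta| < d -> 0 < Q.[x] * Q.[eta].
  move=> /Qd; case/orP: (lt_total Qeta) => Q0.
    by rewrite (ltr0_norm Q0) ltr_norml => /andP[? ?]; rewrite nmulr_rgt0 //; lra.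
  by rewrite (gtr0_norm Q0) ltr_norml => /andP[? ?]; rewrite pmulr_rgt0 //; lra.
have nzLQ : L * Q.[eta] != 0 by rewrite mulf_neq0.
have Qsq : 0 < Q.[eta] ^+ 2 by rewrite exprn_even_gt0.
have sgn x : `|x - eta| < d -> (L * Q.[eta]) * (x - eta) < 0 ->
    L * (Q * ('X - eta%:P)).[x] < 0.
  move=> /Qpos Qx Lx; rewrite hornerM hornerXsubC.
  rewrite -(pmulr_rlt0 _ Qsq).
  have -> : Q.[eta] ^+ 2 * (L * (Q.[x] * (x - eta))) =
     (Q.[x] * Q.[eta]) * (L * Q.[eta] * (x - eta)) by ring.
  by rewrite pmulr_rlt0.
case/orP: (lt_total nzLQ) => s.
  exists (eta, eta + d) => [|x /= /andP[x1 x2]]; first by rewrite /=; lra.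
  apply: sgn; last by rewrite nmulr_rlt0 // subr_gt0.
  by rewrite ltr_norml; apply/andP; split; lra.
exists (eta - d, eta) => [|x /= /andP[x1 x2]]; first by rewrite /=; lra.
apply: sgn; last by rewrite pmulr_rlt0 // subr_lt0.
by rewrite ltr_norml; apply/andP; split; lra.
Qed.

End SignChange.

Section PrimeDivisor.
Variable R : realType.

(** Consecutive fractions of this shape are [N / N ^ (j + 2)] apart, which is below [b - a] for
    large [j]. *)
Lemma fraction_in_interval (a b : R) (N : nat) : (1 < N)%N -> a < b ->
  exists (u : int) (j : nat),
    a < (1 + N%:Z * u)%:~R / N%:R ^+ j.+2 < b.
Proof.
move=> N_gt1 ab.
have N0 : 0 < N%:R :> R by rewrite ltr0n ltnW.
pose j := Num.bound (b - a)^-1.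
have jP : (b - a)^-1 < N%:R ^+ j.+1.
  apply: lt_trans (_ : j%:R < _).
    by apply: archi_boundP; rewrite invr_ge0 subr_ge0 ltW.
  rewrite -natrX ltr_nat; apply: (ltn_trans (ltn_expl j N_gt1)).
  by rewrite ltn_exp2l.
pose y : R := N%:R ^+ j.+2.
have y0 : 0 < y by rewrite exprn_gt0.
(* The least integer [u] with [a * y < 1 + N * u]. *)
pose u := Num.floor ((a * y - 1) / N%:R) + 1.
exists u, j; rewrite -/y.
have Eu : (Num.floor ((a * y - 1) / N%:R))%:~R = u%:~R - 1 :> R.
  by rewrite /u intrD addrK.
have := floor_le ((a * y - 1) / N%:R); have := lt_succ_floor ((a * y - 1) / N%:R).
rewrite -/u {}Eu; clearbody u; rewrite ltr_pdivrMr // ler_pdivlMr //.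
rewrite ltr_pdivlMr // ltr_pdivrMr // intrD intrM -[in (N%:Z)%:~R]pmulrn mulrBl mul1r.
move=> h1 h2; apply/andP; split; first by lra.
have : N%:R < (b - a) * y; last by lra.
rewrite /y exprS mulrCA -[ltLHS]mulr1 ltr_pM2l // -ltr_pdivrMl ?subr_gt0 //.
by rewrite mulr1.
Qed.

Lemma simple_root_prime (G : {poly int}) (eta : R) (P : nat) :
    root (map_poly intr G) eta -> ~~ root (map_poly intr G^`()) eta ->
    (0 < P)%N ->
  exists p, [/\ prime p, (p %% 4 = 3)%N, ~~ (p %| P)%N &
    forall F : fieldType, p \in [pchar F] ->
      exists2 t : F, t ^+ p = t & root (map_poly intr G) t].
Proof.
move=> Geta G'eta P_gt0.
have nzG : G != 0.
  by apply: contraNneq G'eta => ->; rewrite deriv0 map_poly0 root0.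
set L := lead_coef G; have nzL : L != 0 by rewrite lead_coef_eq0.
have nzLR : L%:~R != 0 :> R by rewrite intr_eq0.
rewrite -deriv_map in G'eta.
have [[a b] /= ab sgn] := simple_root_sign_change Geta G'eta nzLR.
(* The factor 4 controls [h] modulo 4, [P] excludes its own prime divisors, and [L ^ 2], positive
   whatever the sign of [L], makes [L] divide [y]. *)
pose N := (4 * P * `|L| ^ 2)%N.
have N_gt1 : (1 < N)%N.
  have : (0 < P * `|L| ^ 2)%N by rewrite muln_gt0 P_gt0 expn_gt0 absz_gt0 nzL.
  by rewrite /N -mulnA; lia.
have [u [j /sgn]] := fraction_in_interval N_gt1 ab.
set x := 1 + N%:Z * u => Gxy.
(* [w] is [y / L]; since the exponent in [y] is at least 2, a factor [N] remains in [w]. *)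
pose y : int := N%:Z ^+ j.+2; pose w : int := 4 * P%:Z * L * N%:Z ^+ j.+1.
have NE : N%:Z = 4 * P%:Z * L ^+ 2.
  by rewrite /N 2!PoszM -abszX gez0_abs ?sqr_ge0.
have yE : y = L * w by rewrite /y /w exprS {1}NE; ring.
have w_dv : (N%:Z %| w)%Z by rewrite /w exprS dvdz_mull ?dvdz_mulr.
have [m sG] : exists m, size G = m.+1.
  by exists (size G).-1; rewrite prednK // size_poly_gt0.
have Lm : L = G`_m by rewrite /L lead_coefE sG.
(* [y ^+ m * G.[x / y] = L * h], where [h < 0] and [h = 1 mod N]. *)
pose h := x ^+ m + \sum_(i < m) G`_i * x ^+ i * (w * y ^+ (m - i.+1)).
have y_gt0 : (0 : R) < y%:~R by rewrite ltr0z exprn_gt0 // ltz_nat ltnW.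
(* Clearing denominators over an arbitrary field: applied in [R] to get the sign of [h], and in
   characteristic [p] to get a root of [G]. *)
have hom (F : fieldType) : y%:~R != 0 :> F ->
    (map_poly intr G).[x%:~R / y%:~R] * y%:~R ^+ m = (L * h)%:~R :> F.
  rewrite {}/h; clearbody w y x => nzy; rewrite (@horner_coef_wide _ m.+1); last first.
    by rewrite -sG; apply: size_poly.
  rewrite big_ord_recr /= mulrDl addrC mulrDr [RHS]rmorphD /=; congr (_ + _).
    by rewrite coef_map /= -Lm expr_div_n mulrA divfK ?expf_neq0 // [RHS]rmorphM [in RHS]rmorphXn.
  rewrite mulr_sumr mulr_suml [RHS]rmorph_sum; apply: eq_bigr => i _.
  have Em : m = (i + (m - i.+1).+1)%N by rewrite -subSn // subSS subnKC // ltnW.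
  rewrite [in y%:~R ^+ m]Em exprD coef_map /= expr_div_n.
  rewrite !mulrA divfK ?expf_neq0 // exprS.
  rewrite {1}yE !rmorphM /= !rmorphXn /=; ring.
(* [L ^ 2 * h] has the sign of [L * G.[x / y]], negative by the choice of the interval. *)
have h_lt0 : h < 0.
  rewrite -(ltrz0 R) -(pmulr_rlt0 _ (_ : 0 < L%:~R ^+ 2)); last first.
    by rewrite exprn_even_gt0.
  rewrite expr2 -mulrA -[L%:~R * h%:~R]rmorphM /= -hom ?gt_eqF //.
  rewrite mulrA pmulr_llt0 ?exprn_gt0 //.
  move: Gxy; rewrite /y rmorphXn /=; exact.
have h_mod : (N%:Z %| h - 1)%Z.
  rewrite /h addrAC rpredD //.
    by rewrite -[1](expr1n _ m) subrXX dvdz_mulr // /x addrC addKr dvdz_mulr.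
  by rewrite rpred_sum // => i _; rewrite dvdz_mull // dvdz_mulr.
(* A negative integer that is 1 mod 4 has an absolute value that is 3 mod 4. *)
have [|p [p_pr p3 p_dv]] := @prime_divisor_3mod4 `|h|%N.
  have: (4%:Z %| h - 1)%Z.
    by apply: dvdz_trans h_mod; rewrite /N -mulnA PoszM dvdz_mulr.
  by move: h_lt0; lia.
have p_dvz : (p%:Z %| h)%Z by rewrite -[(_ %| _)%Z]/(p %| `|h|)%N.
(* [p] divides [h] while [N] divides [h - 1]. Hence [y], a power of [N], is invertible in
   characteristic [p]. *)
have pN : ~~ (p %| N)%N.
  apply/negP => pN; have: (p%:Z %| h - (h - 1))%Z.
    by rewrite rpredB //; apply: dvdz_trans h_mod.
  rewrite opprB addrC subrK dvdz1 => /eqP /= p1.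
  by rewrite p1 in p_pr.
exists p; split=> //.
  by apply: contra pN => pP; rewrite /N -mulnA dvdn_mull ?dvdn_mulr.
move=> F charF.
have nzy : y%:~R != 0 :> F.
  rewrite /y rmorphXn expf_neq0 //= -[(N%:Z)%:~R]pmulrn.
  by rewrite -(dvdn_pcharf charF).
have Fz (z : int) : (z%:~R : F) ^+ p = z%:~R.
  by rewrite -(pFrobenius_autE charF) rmorph_int.
exists (x%:~R / y%:~R); first by rewrite expr_div_n !Fz.
move: (hom F nzy) => /eqP; rewrite rootE.
have /dvdzP[k Dh] := p_dvz; move: Dh nzy; clearbody h w y x => -> nzy.
rewrite !rmorphM /= -[(p%:Z)%:~R]pmulrn (pcharf0 charF) !mulr0.
by rewrite mulf_eq0 (negbTE (expf_neq0 m nzy)) orbF.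
Qed.

End PrimeDivisor.

(** * Denominators of algebraic integers *)

Lemma int_root_of_rat_root (K : fieldType) (j : {rmorphism rat -> K}) (p : {poly rat}) x :
    p != 0 -> root (map_poly j p) x ->
  exists2 q : {poly int}, q != 0 & root (map_poly intr q) x.
Proof.
have [q [a nza ->]] := rat_poly_scale p => nzp px; exists q.
  by apply: contraNneq nzp => ->; rewrite map_poly0 scaler0.
move: px; rewrite map_polyZ /= rootZ ?fmorph_eq0 ?invr_eq0 ?intr_eq0 //.
rewrite -map_poly_comp; congr (is_true (root _ _)).
by apply: eq_map_poly => z; rewrite /= rmorph_int.
Qed.

Section AlgebraicInteger.
Variable E : fieldExtType rat.
Implicit Types x : E.

Lemma intr_eq0_ext (m : int) : (m%:~R == 0 :> E) = (m == 0).
Proof. by rewrite -(rmorph_int (in_alg E)) fmorph_eq0 intr_eq0. Qed.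

Lemma int_root_ext x : exists2 q : {poly int}, q != 0 & root (map_poly intr q) x.
Proof.
have /polyOver1P[p Dp] := minPolyOver 1 x.
apply: (@int_root_of_rat_root _ (in_alg E) p); last by rewrite -Dp root_minPoly.
by apply: contraTneq (monic_minPoly 1 x) => p0; rewrite Dp p0 map_poly0 monicE lead_coef0 eq_sym oner_eq0.
Qed.

(** If [q] has degree [n] and leading coefficient [L], then [L ^ (n - 1) * q.[x]] is a monic integer
    polynomial in [L * x]. *)
Lemma alg_integer_scale x : exists2 m : int, m != 0 & m%:~R * x \in @alg_integer E.
Proof.
have [q nzq qx] := int_root_ext x.
set L := lead_coef q; have nzL : L != 0 by rewrite lead_coef_eq0.
exists L => //; apply/alg_integerP.
have [n sq] : exists n, size q = n.+1.
  by exists (size q).-1; rewrite prednK // size_poly_gt0.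
have q1 : (1 < size q)%N.
  have <- : size (map_poly intr q : {poly E}) = size q.
    by rewrite size_map_poly_id0 // intr_eq0_ext.
  by apply: root_size_gt1 qx; rewrite map_poly_eq0_id0 // intr_eq0_ext.
pose r := 'X^n + \poly_(i < n) (q`_i * L ^+ (n - i.+1)).
exists r.
  rewrite monicE lead_coefDl ?lead_coefXn // size_polyXn ltnS.
  exact: size_poly.
rewrite /r rmorphD /= map_polyXn rootE hornerD hornerXn.
rewrite (horner_coef_wide _ (leq_trans (size_poly _ _) (size_poly _ _))).
move: qx; rewrite rootE (@horner_coef_wide _ n.+1); last by rewrite -sq size_poly.
rewrite big_ord_recr /= coef_map /= -[q`_n]/(q`_n.+1.-1) -sq -lead_coefE -/L.
move/eqP=> qx.
have Dn : n = n.-1.+1 by move: q1; rewrite sq; case: (n).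
suff -> : (L%:~R * x) ^+ n + \sum_(i < n)
    (map_poly intr (\poly_(i < n) (q`_i * L ^+ (n - i.+1))))`_i * (L%:~R * x) ^+ i
  = L%:~R ^+ n.-1 * (\sum_(i < n) (map_poly intr q)`_i * x ^+ i + L%:~R * x ^+ n).
  by rewrite qx mulr0.
rewrite mulrDr addrC; congr (_ + _).
  rewrite mulr_sumr; apply: eq_bigr => i _.
  rewrite !coef_map /= coef_poly ltn_ord rmorphM rmorphXn /= exprMn.
  have -> : n.-1 = (n - i.+1 + i)%N by move: (ltn_ord i); lia.
  by rewrite exprD; ring.
by rewrite exprMn {1}Dn exprSr mulrA.
Qed.
End AlgebraicInteger.

Section IntegralPolynomials.
Variable E : fieldExtType rat.
Local Notation O := (@alg_integer E).

Lemma alg_integer_horner (p : {poly int}) x :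
  x \in O -> (map_poly intr p).[x] \in O.
Proof.
move=> Ox; apply: rpred_horner => //.
by apply/polyOverP => i; rewrite coef_map rpred_int.
Qed.

(** Once powers of [X] are removed from an integral equation of [a], its constant term is a nonzero
    multiple of [a]. *)
Lemma alg_integer_divides_int a : a \in O -> a != 0 ->
  exists2 b, b \in O & exists2 M : int, M != 0 & a * b = M%:~R.
Proof.
move=> Oa nza; have /alg_integerP[p mon_p pa] := Oa.
have [m [q]] := multiplicity_XsubC p 0; rewrite monic_neq0 //= subr0 => q0 Dp.
have qa : root (map_poly intr q) a.
  move: pa; rewrite Dp rmorphM rmorphXn /= map_polyX rootM => /orP[] //.
  by rewrite rootE hornerXn expf_eq0 (negbTE nza) andbF.
(* [r] is [(q - q.[0]) / X], so that [q.[a] = 0] reads [a * - r.[a] = q.[0]]. *)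
have /factor_theorem[r Dr] : root (q - q.[0]%:P) 0.
  by rewrite rootE !hornerE subrr.
exists (- (map_poly intr r).[a]); first by rewrite rpredN alg_integer_horner.
have Dq : q = r * 'X + q.[0]%:P by rewrite -['X]subr0 -Dr subrK.
exists q.[0] => //; move: qa; rewrite {1}Dq rmorphD rmorphM /= map_polyX map_polyC.
rewrite rootE hornerD hornerMX hornerC addrC addr_eq0 => /eqP ->.
by rewrite mulrN mulrC.
Qed.

(** The claim is carried to [algC], where rational algebraic integers are known to be integers. *)
Lemma rat_alg_integer (c : rat) : c%:A \in O -> exists m : int, c%:A = m%:~R :> E.
Proof.
move=> /alg_integerP[p mon_p pc].
suff : (ratr c : algC) \in Num.int.
  move=> /intrP[m /eqP]; rewrite -(ratr_int _ m) fmorph_eq => /eqP ->.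
  by exists m; rewrite -(rmorph_int (in_alg E)).
apply: Cint_rat_Aint; first exact: rpred_rat.
have pc' : root (map_poly intr p) c.
  rewrite -(fmorph_root (in_alg E)) -map_poly_comp.
  congr (is_true (root _ _)): pc.
  by apply: eq_map_poly => z; exact: esym (rmorph_int (in_alg E) z).
apply: (@root_monic_Aint (map_poly intr p)).
- have -> : map_poly intr p = map_poly (ratr : rat -> algC) (map_poly intr p).
    by rewrite -map_poly_comp; apply: eq_map_poly => z; rewrite /= ratr_int.
  by rewrite fmorph_root.
- by rewrite monic_map.
- by apply/polyOverP => i; rewrite coef_map /= rpred_int.
Qed.

End IntegralPolynomials.

Section IntegralBasis.
Variable E : splittingFieldType rat.
Local Notation O := (@alg_integer E).
Hypothesis galE : galois 1%AS {:E}%AS.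

Lemma alg_integer_gal (t : gal_of {:E}) a : a \in O -> t a \in O.
Proof.
move=> /alg_integerP/(integral_rmorph t) int_ta; apply/alg_integerP.
case: int_ta => p mon_p pta; exists p => //; congr (is_true (root _ _)): pta.
by apply: eq_map_poly => c; rewrite /= rmorph_int.
Qed.

Lemma alg_integer_fixed a : a \in O ->
  (forall t, t \in 'Gal({:E} / 1)%g -> t a = a) -> exists m : int, a = m%:~R.
Proof.
move=> Oa fix_a.
have : a \in fixedField 'Gal({:E} / 1)%g by apply/fixedFieldP; rewrite ?memvf.
have -> := galois_fixedField galE => /vlineP[c Da].
by move: Oa; rewrite Da => /rat_alg_integer.
Qed.

(* Euler's formula: the interpolation polynomial of the conjugates of [a] at
   those of [z] has integer coefficients and takes the value [a * delta] at [z],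
   where [delta] is the derivative at [z] of the minimal polynomial. *)
Lemma alg_integer_denominator z : z \in O -> <<1; z>>%VS = {:E}%VS ->
  exists2 D : int, D != 0 &
    forall a, a \in O -> exists p : {poly int}, D%:~R * a = (map_poly intr p).[z].
Proof.
move=> Oz gen_z.
pose P a := \sum_(t in 'Gal({:E} / 1)%g)
  t a *: \prod_(u in 'Gal({:E} / 1)%g | u != t) ('X - (u z)%:P).
pose delta := \prod_(u in 'Gal({:E} / 1)%g | u != 1%g) (z - u z).
have P_O a : a \in O -> P a \is a polyOver O.
  move=> Oa; apply: rpred_sum => t _; apply: polyOverZ.
    exact: alg_integer_gal.
  by apply: rpred_prod => u _; rewrite polyOverXsubC alg_integer_gal.
(* Composing with [s] permutes the group, hence the terms of the sum and the factors of the
   products. *)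
have P_fix a s : s \in 'Gal({:E} / 1)%g -> map_poly s (P a) = P a.
  move=> Gs; rewrite {2}/P (reindex_inj (mulIg s)) rmorph_sum /=.
  apply: eq_big => [t|t Gt]; first by rewrite groupMr.
  rewrite map_polyZ galM ?memvf //; congr (_ *: _).
  rewrite [RHS](reindex_inj (mulIg s)) rmorph_prod /=.
  apply: eq_big => [u|u _]; first by rewrite groupMr //; rewrite (inj_eq (mulIg s)).
  by rewrite rmorphB /= map_polyX map_polyC galM ?memvf.
have P_int a : a \in O -> exists p : {poly int}, P a = map_poly intr p.
  move=> Oa.
  have /choice[c Dc] : forall i, exists m : int, (P a)`_i = m%:~R.
    move=> i; apply: alg_integer_fixed => [|t Gt].
      by have /polyOverP := P_O a Oa; apply.
    by rewrite -{2}(P_fix a t Gt) coef_map.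
  exists (\poly_(i < size (P a)) c i); apply/polyP => i.
  rewrite coef_map coef_poly; case: ltnP => [_|le_i]; first exact: Dc.
  by rewrite nth_default.
(* Every term with [t] not the identity contains the factor ['X - z%:P]. *)
have P_z a : (P a).[z] = a * delta.
  rewrite horner_sum (bigD1 1%g) //= [X in _ + X]big1 ?addr0 => [|t /andP[Gt nt]].
    rewrite hornerZ gal_id horner_prod; congr (_ * _).
    by apply: eq_bigr => u _; rewrite hornerXsubC.
  rewrite hornerZ horner_prod (bigD1 1%g) /=; last by rewrite group1 eq_sym.
  by rewrite hornerXsubC gal_id subrr mul0r mulr0.
(* An automorphism fixing the generator [z] is the identity, so no factor vanishes. *)
have nz_delta : delta != 0.
  apply/prodf_neq0 => u /andP[Gu]; apply: contraNneq => /eqP.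
  rewrite subr_eq0 => /eqP zu; apply/gal_eqP => b _; rewrite gal_id.
  have: b \in <<1; z>>%VS by rewrite gen_z memvf.
  move=> /Fadjoin_polyP[p Kp ->].
  by rewrite -horner_map (fixedPoly_gal (sub1v _) Gu) //= -zu.
have O_delta : delta \in O.
  by apply: rpred_prod => u _; rewrite rpredB // alg_integer_gal.
(* The cofactor [d] turns the denominator [delta] into an integer: [P (a * d)] takes the value
   [D * a] at [z]. *)
have [d Od [D nzD Dd]] := alg_integer_divides_int O_delta nz_delta.
exists D => // a Oa; have [p Dp] := P_int (a * d) (rpredM Oa Od).
by exists p; rewrite -Dp P_z -Dd mulrC [delta * d]mulrC mulrA.
Qed.

End IntegralBasis.

(** * Coordinates over a real primitive element *)

Section MinimalIntPoly.
Variable R : numFieldType.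

(** [G] is the primitive part of a nonzero integer polynomial of least degree vanishing at [eta].
    Pseudo-division and Gauss's lemma give divisibility over the integers; minimality makes the root
    simple. *)
Lemma minimal_int_poly (eta : R) :
    (exists2 q : {poly int}, q != 0 & root (map_poly intr q) eta) ->
  exists G : {poly int}, [/\ root (map_poly intr G) eta,
    ~~ root (map_poly intr G^`()) eta
    & forall p : {poly int}, root (map_poly intr p) eta -> exists r, p = G * r].
Proof.
move=> alg_eta; pose Q (q : {poly int}) := q != 0 /\ root (map_poly intr q) eta.
have exQ : exists n, `[< exists2 q, Q q & size q = n >].
  by have [q nzq qeta] := alg_eta; exists (size q); apply/asboolP; exists q.
case: (ex_minnP exQ) => n /asboolP[q [nzq qeta] sq] min_n.
have min_q p : root (map_poly intr p) eta -> (size p < size q)%N -> p = 0.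
  move=> peta; apply: contraTeq => nzp; rewrite -leqNgt sq; apply: min_n.
  by apply/asboolP; exists p.
have q_dv p : root (map_poly intr p) eta -> exists r, p = zprimitive q * r.
  move=> peta; suff /dvdpP_int[r ->] : q %| p by exists r.
  apply/Pdiv.Idomain.modp_eq0P; apply: min_q; last first.
    by rewrite Pdiv.Idomain.ltn_modpN0.
  have := congr1 (fun p => (map_poly intr p).[eta] : R) (Pdiv.Idomain.divp_eq p q).
  rewrite linearZ rmorphD rmorphM /= hornerD hornerM hornerZ.
  by rewrite (rootP qeta) (rootP peta) !mulr0 add0r => /esym/rootP.
have sz : size (zprimitive q) = size q by apply: size_zprimitive.
exists (zprimitive q); split=> //.
  move: qeta; rewrite {1}[q]zpolyEprim linearZ /= rootZ //.
  by rewrite intr_eq0 zcontents_eq0.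
have q1 : (1 < size q)%N.
  have <- : size (map_poly intr q : {poly R}) = size q.
    by rewrite size_map_poly_id0 // intr_eq0 lead_coef_eq0.
  by apply: root_size_gt1 qeta; rewrite map_poly_eq0_id0 // intr_eq0 lead_coef_eq0.
apply/negP => /min_q; rewrite size_deriv sz prednK ?leqnn 1?ltnW // => /(_ isT)/eqP.
by rewrite -size_poly_eq0 size_deriv sz -subn1 subn_eq0 leqNgt q1.
Qed.

End MinimalIntPoly.

Section PrimitiveElement.
Variables (R : rcfType) (E : splittingFieldType rat).
Variable iota : {rmorphism E -> R[i]%C}.

Lemma conjC_complex (x : R[i]%C) : Num.conj x = conjc x.
Proof. by []. Qed.

(** By normality the conjugate of [iota z] is again in the image of [iota], hence algebraic, and
    ['i] is algebraic too. *)
Lemma algebraic_Re_Im (z : E) :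
  algebraicOver (ratr : rat -> R) (complex.Re (iota z)) /\
  algebraicOver (ratr : rat -> R) (complex.Im (iota z)).
Proof.
have alg_iota y : algebraicOver (ratr : rat -> R[i]%C) (iota y).
  have [q nzq qy] := int_root_ext y; exists (map_poly intr q).
    by rewrite map_poly_eq0_id0 // intr_eq0 lead_coef_eq0.
  rewrite -map_poly_comp; have := qy; rewrite -(fmorph_root iota) -map_poly_comp.
  by congr (is_true (root _ _)); apply: eq_map_poly => c; rewrite /= ratr_int rmorph_int.
have algRC (x : R) : algebraicOver (ratr : rat -> R[i]%C) x%:C%C ->
    algebraicOver (ratr : rat -> R) x.
  case=> p nzp px; exists p => //.
  rewrite -(fmorph_root (real_complex R)) -map_poly_comp.
  congr (is_true (root _ _)): px.
  by apply: eq_map_poly => c; rewrite /= fmorph_rat.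
have alg2 : algebraicOver (ratr : rat -> R[i]%C) 2.
  by rewrite -(ratr_nat _ 2); apply: algebraic_id.
have alg_i : algebraicOver (ratr : rat -> R[i]%C) 'i%C.
  exists ('X^2 + 1); first by rewrite monic_neq0 // monicE lead_coefDl ?lead_coefXn ?size_polyXn ?size_poly1.
  rewrite rmorphD rmorph1 /= map_polyXn rootE hornerD hornerXn hornerC.
  by rewrite eq_complex /= mulr0 mul1r sub0r addNr mulr0 mul0r !addr0 !eqxx.
split; apply: algRC; rewrite ?ReJ_add ?ImJ_sub -conjC_complex -(field_conjE iota).
  by apply: algebraic_div => //; apply: algebraic_add.
by apply: algebraic_mul => //; apply: algebraic_div => //; apply: algebraic_sub.
Qed.

(** The primitive element theorem is applied in [R] to the two coordinates of [iota z]; [eta] need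
    not come from [E]. [D] clears the denominators. *)
Lemma real_primitive_element (z : E) : exists eta : R,
  (exists2 q : {poly int}, q != 0 & root (map_poly intr q) eta) /\
  exists2 D : int, D != 0 & exists U V : {poly int},
    D%:~R * iota z = ((map_poly intr U).[eta] +i* (map_poly intr V).[eta])%C.
Proof.
have [[p nzp pr] [q nzq qs]] := algebraic_Re_Im z.
have [n] := pchar0_PET nzp pr nzq qs (@pchar_num _).
set eta := (_ - _) => -[[p1 Dp1] [q1 Dq1]].
exists eta; split.
  have [r nzr reta] : algebraicOver (ratr : rat -> R) eta.
    rewrite /eta.
    apply: algebraic_sub; last by exists p.
    rewrite -mulr_natr -(ratr_nat _ n); apply: algebraic_mul; first by exists q.
    exact: algebraic_id.
  exact: int_root_of_rat_root nzr reta.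
have [U [a nza DU]] := rat_poly_scale p1; have [V [b nzb DV]] := rat_poly_scale q1.
exists (a * b); first by rewrite mulf_neq0.
exists (b *: U), (a *: V).
have scale (w : {poly rat}) (W : {poly int}) (c : int) : c != 0 ->
    w = c%:~R^-1 *: map_poly intr W ->
    c%:~R * (map_poly ratr w).[eta] = (map_poly intr W).[eta] :> R.
  move=> nzc ->; rewrite map_polyZ hornerZ fmorphV rmorph_int mulVKf ?intr_eq0 //.
  by rewrite -map_poly_comp; congr _.[_]; apply: eq_map_poly => k; rewrite /= ratr_int.
have {}DU := scale _ _ _ nza DU; have {}DV := scale _ _ _ nzb DV.
rewrite !linearZ /= !hornerZ -DU -DV Dp1 Dq1.
have int_c (c : int) : c%:~R = (c%:~R : R)%:C%C :> R[i]%C by rewrite rmorph_int.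
rewrite int_c; case: (iota z) => x y; apply/eqP; rewrite eq_complex /=.
by apply/andP; split; apply/eqP; rewrite rmorphM /=; ring.
Qed.

Lemma int_poly_at_gaussian (eta : R) (z : E) (U V : {poly int}) :
    iota z = ((map_poly intr U).[eta] +i* (map_poly intr V).[eta])%C ->
  forall p : {poly int}, exists U' V' : {poly int},
    iota (map_poly intr p).[z]
      = ((map_poly intr U').[eta] +i* (map_poly intr V').[eta])%C.
Proof.
move=> Dz; elim/poly_ind => [|p c [U' [V' IHp]]].
  by exists 0, 0; rewrite !(map_poly0, horner0) rmorph0.
exists (U' * U - V' * V + c%:P), (U' * V + V' * U).
rewrite rmorphD rmorphM /= map_polyX map_polyC hornerD hornerMX hornerC.
rewrite !rmorphD rmorphM IHp Dz rmorph_int !rmorphN !rmorphM /= !map_polyC.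
have -> : c%:~R = (c%:~R : R)%:C%C :> R[i]%C by rewrite rmorph_int.
apply/eqP; rewrite eq_complex /= !hornerE.
by rewrite !eqxx.
Qed.

Lemma alg_integer_gaussian (galE : galois 1%AS {:E}%AS) :
  exists (eta : R) (G : {poly int}) (D : int),
  [/\ root (map_poly intr G) eta, ~~ root (map_poly intr G^`()) eta,
      forall p : {poly int}, root (map_poly intr p) eta -> exists r, p = G * r,
      D != 0
    & forall a, a \in @alg_integer E -> exists U V : {poly int},
      D%:~R * iota a = ((map_poly intr U).[eta] +i* (map_poly intr V).[eta])%C].
Proof.
pose z0 := separable_generator 1%AS {:E}%AS.
have gen_z0 : <<1; z0>>%VS = {:E}%VS.
  by rewrite -eq_adjoin_separable_generator ?sub1v //; have /and3P[] := galE.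
have [eta [alg_eta [c nzc [U [V Dz0]]]]] := real_primitive_element z0.
have [m nzm Oz0] := alg_integer_scale z0.
(* [c] puts the generator in [Z[eta] + i Z[eta]] and [m] makes it integral; a nonzero multiple still
   generates [E]. *)
pose z := (c * m)%:~R * z0.
have nzcm : (c * m)%:~R != 0 :> E by rewrite intr_eq0_ext mulf_neq0.
have Oz : z \in @alg_integer E by rewrite /z rmorphM -mulrA rpredM // rpred_int.
have gen_z : <<1; z>>%VS = {:E}%VS.
  apply/eqP; rewrite eqEsubv subvf -gen_z0; apply/FadjoinP; split.
    exact: subv_adjoin.
  have -> : z0 = (c * m)%:~R^-1 *: z.
    by rewrite /z mulrzl -scaler_int scalerK // intr_eq0 mulf_neq0.
  by rewrite memvZ ?memv_adjoin.
have Dz : iota z = ((map_poly intr (m *: U)).[eta] +i* (map_poly intr (m *: V)).[eta])%C.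
  rewrite /z [c * m]mulrC rmorphM rmorph_int intrM -mulrA Dz0 !linearZ /= !hornerZ.
  have -> : m%:~R = (m%:~R : R)%:C%C :> R[i]%C by rewrite rmorph_int.
  by apply/eqP; rewrite eq_complex /= !mul0r subr0 addr0 !eqxx.
have [D nzD DO] := alg_integer_denominator galE Oz gen_z.
have [G [Geta G'eta G_dv]] := minimal_int_poly alg_eta.
exists eta, G, D; split=> // a /DO[p Dp].
have [U' [V' DUV]] := int_poly_at_gaussian Dz p; exists U', V'.
by rewrite -DUV -Dp rmorphM rmorph_int.
Qed.

End PrimitiveElement.

(** * Reduction modulo p *)

Lemma sqrtN1_finField (F : finFieldType) (p : nat) :
    prime p -> (p %% 4 = 3)%N -> #|F| = (p ^ 2)%N ->
  p \in [pchar F] /\ exists2 w : F, w ^+ 2 = -1 & w ^+ p = - w.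
Proof.
move=> p_pr p3 cardF; split; first exact: card_finPcharP cardF p_pr.
have p_gt1 := prime_gt1 p_pr.
have Dp : p = (p %/ 4 * 4 + 3)%N by rewrite {1}(divn_eq p 4) p3.
have [k Dk] : exists k, (#|F| = (4 * k).+1)%N.
  by exists ((p ^ 2).-1 %/ 4)%N; rewrite cardF; move: Dp; set s := (p %/ 4)%N => ->; rewrite -mulnn; lia.
have k_gt0 : (0 < k)%N by rewrite lt0n; apply/eqP => k0; move: Dk; rewrite cardF k0 -mulnn; lia.
(* [X ^ (2 k) - 1] has at most [2 k] roots, fewer than the [4 k] units. For such an [a], [a ^ (2 k)]
   is [-1], so [a ^ k] is a square root of [-1]. *)
have [a nza a2k] : exists2 a : F, a != 0 & a ^+ (2 * k) != 1.
  apply/exists_inP; rewrite -negb_forall_in; apply/negP => /forall_inP all1.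
  have : (size (enum (predC1 (0%R : F))) <= 2 * k)%N.
    have k2_gt0 : (0 < 2 * k)%N by rewrite muln_gt0.
    apply: (max_unity_roots k2_gt0 _ (enum_uniq _)).
    apply/allP => x; rewrite mem_enum inE => nzx; apply/unity_rootP.
    exact/eqP/all1.
  by rewrite -cardE cardC1 Dk /=; lia.
have a4k : a ^+ (2 * k) ^+ 2 = 1.
  rewrite -exprM; apply: (mulIf nza); rewrite mul1r -exprSr.
  by rewrite -[RHS](expf_card a) Dk; congr (_ ^+ _); lia.
have w2 : a ^+ k ^+ 2 = -1.
  move/eqP: a4k; rewrite sqrf_eq1 (negbTE a2k) /= => /eqP <-.
  by rewrite -exprM mulnC.
(* As [w ^ 4 = 1] and [p] is 3 mod 4, [w ^ p = w ^ 3 = - w]. *)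
exists (a ^+ k) => //; rewrite {1}Dp exprD mulnC -[4%N]/(2 * 2)%N -mulnA exprM w2.
by rewrite exprM sqrrN !expr1n mul1r exprS w2 mulrN1.
Qed.

Section StarHom.
Variables (R : rcfType) (E : splittingFieldType rat).
Variable iota : {rmorphism E -> R[i]%C}.
Variables (eta : R) (G : {poly int}) (D : int).
Hypothesis G_dv : forall r : {poly int},
  root (map_poly intr r) eta -> exists s, r = G * s.
Hypothesis gaussian : forall a, a \in @alg_integer E ->
  exists U V : {poly int},
    D%:~R * iota a = ((map_poly intr U).[eta] +i* (map_poly intr V).[eta])%C.
Variables (F : finFieldType) (p : nat) (t w : F).
Hypotheses (charFp : p \in [pchar F]) (nzD : D%:~R != 0 :> F).
Hypotheses (tp : t ^+ p = t) (Gt : root (map_poly intr G) t).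
Hypotheses (w2 : w ^+ 2 = -1) (wp : w ^+ p = - w).

(** This makes [eta |-> t] well defined: the difference is a multiple of [G], which vanishes at
    [t]. *)
Lemma int_poly_eval_transfer (U V : {poly int}) :
    (map_poly intr U).[eta] = (map_poly intr V).[eta] ->
  (map_poly intr U).[t] = (map_poly intr V).[t].
Proof.
move=> eqUV; apply/eqP; rewrite -subr_eq0 -hornerN -hornerD -rmorphB /=.
have [|s ->] := G_dv (r := U - V).
  by rewrite rootE rmorphB hornerD hornerN /= eqUV subrr.
by rewrite rmorphM /= hornerM (rootP Gt) mul0r.
Qed.

Lemma int_poly_frobenius (U : {poly int}) :
  (map_poly intr U).[t] ^+ p = (map_poly intr U).[t].
Proof.
rewrite -!(pFrobenius_autE charFp) -horner_map /= pFrobenius_autE tp.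
rewrite -map_poly_comp; congr _.[_]; apply: eq_map_poly => c.
by rewrite /= rmorph_int.
Qed.

Lemma gaussian_star_hom :
  exists f : {rmorphism int_ring E -> F},
    star_preserving (int_conj iota) (@qpow F p) f.
Proof.
(* The coordinates are arbitrary choices; each identity for [g] below compares real and imaginary
   parts, then transfers them from [eta] to [t]. *)
have /choice[UV DUV] : forall a : int_ring E, exists UV : {poly int} * {poly int},
    D%:~R * int_embed iota a
      = ((map_poly intr UV.1).[eta] +i* (map_poly intr UV.2).[eta])%C.
  by move=> a; have [U [V DUV]] := gaussian (int_valP a); exists (U, V).
pose ev r := (map_poly intr r).[t] : F.
(* [g] reduces [D * a], whence the factors [D] in [gM] and [g1]; dividing by the invertible [D]
   gives the homomorphism. *)
pose g a := ev (UV a).1 + w * ev (UV a).2; pose f a := g a / D%:~R.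
have intC (c : int) : c%:~R = (c%:~R : R)%:C%C :> R[i]%C by rewrite rmorph_int.
have gB a b : g (a - b) = g a - g b.
  have := DUV (a - b); rewrite /int_embed !rmorphB /= mulrBr.
  rewrite -!/(int_embed iota _) !DUV => -[U_ V_].
  have := @int_poly_eval_transfer ((UV a).1 - (UV b).1) (UV (a - b)).1.
  have := @int_poly_eval_transfer ((UV a).2 - (UV b).2) (UV (a - b)).2.
  rewrite !rmorphB /= !hornerD !hornerN U_ V_ => /(_ erefl) e2 /(_ erefl) e1.
  by rewrite /g /ev -e1 -e2; ring.
have gM a b : g (a * b) * D%:~R = g a * g b.
  have : D%:~R * (D%:~R * int_embed iota (a * b))
       = (D%:~R * int_embed iota a) * (D%:~R * int_embed iota b).
    by rewrite /int_embed !rmorphM /=; ring.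
  rewrite !DUV intC => /eqP; rewrite eq_complex /= => /andP[/eqP e1 /eqP e2].
  have := @int_poly_eval_transfer (D *: (UV (a * b)).1)
    ((UV a).1 * (UV b).1 - (UV a).2 * (UV b).2).
  have := @int_poly_eval_transfer (D *: (UV (a * b)).2)
    ((UV a).1 * (UV b).2 + (UV a).2 * (UV b).1).
  rewrite !rmorphB !rmorphD !rmorphM !linearZ /= !(hornerE, hornerD, hornerZ, hornerM).
  move: e1 e2; rewrite !mul0r subr0 addr0 => -> ->.
  move=> /(_ erefl) e2 /(_ erefl) e1.
  rewrite mulrC /g mulrDr [D%:~R * (w * _)]mulrCA /ev e1 e2.
  have -> x y z s : (x + w * y) * (z + w * s) = x * z + w ^+ 2 * (y * s) + w * (x * s + y * z).
    by ring.
  by rewrite w2 mulN1r.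
have g1 : g 1 = D%:~R.
  have := DUV 1; rewrite /int_embed !rmorph1 mulr1 intC => -[U_ V_].
  have := @int_poly_eval_transfer D%:P (UV 1).1.
  have := @int_poly_eval_transfer 0%:P (UV 1).2.
  rewrite -U_ -V_ !map_polyC !hornerC /= !mulr0z => /(_ erefl) e2 /(_ erefl) e1.
  by rewrite /g /ev -e1 -e2 mulr0 addr0.
(* Conjugation negates the second coordinate; the Frobenius fixes values at [t] and negates [w]. *)
have gJ a : g (int_conj iota a) = g a ^+ p.
  have := DUV (int_conj iota a); rewrite int_conjE.
  have -> : D%:~R * (int_embed iota a)^* = (D%:~R * int_embed iota a)^* :> R[i]%C.
    by rewrite rmorphM rmorph_int.
  rewrite !DUV conjC_complex /= => -[U_ V_].
  have := @int_poly_eval_transfer (UV a).1 (UV (int_conj iota a)).1.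
  have := @int_poly_eval_transfer (- (UV a).2) (UV (int_conj iota a)).2.
  rewrite !rmorphN /= !hornerN U_ V_ => /(_ erefl) e2 /(_ erefl) e1.
  rewrite /g /ev -e1 -e2 -(pFrobenius_autE charFp) rmorphD rmorphM /=.
  by rewrite !pFrobenius_autE !int_poly_frobenius wp mulrN mulNr.
have f_zmod : zmod_morphism f by move=> a b; rewrite /f gB mulrBl.
have f_monoid : monoid_morphism f.
  split=> [|a b]; first by rewrite /f g1 divff.
  by rewrite /f mulf_div -gM -mulf_div divff // mulr1.
pose fZ := GRing.isZmodMorphism.Build _ _ f f_zmod.
pose fM := GRing.isMonoidMorphism.Build _ _ f f_monoid.
pose fR : {rmorphism int_ring E -> F} := HB.pack f fZ fM.
exists fR => a; rewrite /fR /= /f gJ /qpow expr_div_n; congr (_ / _).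
by rewrite -(pFrobenius_autE charFp) rmorph_int.
Qed.

End StarHom.

(** * Gram matrices *)

Section StarDot.

Lemma star_dot_map (A B : pzRingType) (sA : A -> A) (sB : B -> B)
    (f : {rmorphism A -> B}) d (u v : 'cV[A]_d) :
    star_preserving sA sB f ->
  star_dot sB (map_mx f u) (map_mx f v) = f (star_dot sA u v).
Proof.
move=> fs; rewrite /star_dot rmorph_sum; apply: eq_bigr => k _.
by rewrite !mxE rmorphM fs.
Qed.

Lemma star_adj_map (A B : pzRingType) (sA : A -> A) (sB : B -> B)
    (f : {rmorphism A -> B}) m n (M : 'M[A]_(m, n)) :
    star_preserving sA sB f ->
  star_adj sB (map_mx f M) = map_mx f (star_adj sA M).
Proof. by move=> fs; apply/matrixP => i j; rewrite !mxE fs. Qed.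

Lemma star_dot_morph (A : comPzRingType) (s : {rmorphism A -> A}) d (u v : 'cV[A]_d) :
  involutive s -> s (star_dot s u v) = star_dot s v u.
Proof.
move=> sK; rewrite /star_dot rmorph_sum; apply: eq_bigr => k _.
by rewrite rmorphM sK mulrC.
Qed.

End StarDot.

Section Columns.
Variables (F : fieldType) (d n : nat).

(** [c^-1 *: Xi] is a right inverse of [Psi], so it supplies coefficients for every vector. *)
Lemma span_columns (Psi : 'M[F]_(d, n)) (Xi : 'M[F]_(n, d)) (c : F) :
  c != 0 -> Psi *m Xi = c%:M -> <<[seq col j Psi | j : 'I_n]>>%VS = fullv.
Proof.
move=> nzc PX; apply/eqP; rewrite eqEsubv subvf; apply/subvP => v _; set w := Xi *m (c^-1 *: v).
have -> : v = \sum_j w j 0 *: col j Psi.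
  have {1}-> : v = Psi *m w.
    by rewrite mulmxA PX mul_scalar_mx scalerA divff // scale1r.
  apply/colP => i; rewrite mxE summxE; apply: eq_bigr => j _.
  by rewrite !mxE mulrC.
by apply: rpred_sum => j _; apply/memvZ/memv_span/map_f; rewrite mem_enum.
Qed.

End Columns.

Section ComplexGram.
Variables (R : realType) (d n : nat) (Phi : 'M[R[i]%C]_(d, n)).
Local Notation conj := (@Num.conj R[i]%C).
Local Notation gram i j := (star_dot conj (col i Phi) (col j Phi)).

Lemma star_dot_eq0 (u : 'cV[R[i]%C]_d) : star_dot conj u u = 0 -> u = 0.
Proof.
move=> /eqP; rewrite psumr_eq0 => [/allP u0|k _]; last by rewrite mulrC mul_conjC_ge0.
apply/colP => k; rewrite mxE; have := u0 k; rewrite mem_index_enum => /(_ isT).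
by rewrite /= mulrC mul_conjC_eq0 => /eqP.
Qed.

(** Unit rescalings involve square roots that need not be in [int_ring]; the conditions are restated
    as polynomial identities, which homomorphisms preserve. *)
Lemma complex_etf_gram : complex_etf Phi ->
  [/\ exists2 c : R, 0 < c & Phi *m star_adj conj Phi = (c%:C)%C%:M,
      forall i j, gram i i = gram j j
    & forall i j k l, i != j -> k != l ->
        gram i j * gram j i = gram k l * gram l k].
Proof.
case=> frame nz_col eq_norm [b _ eq_angle].
have normE u : cnorm u ^+ 2 = star_dot conj u u by apply: sqrtCK.
split=> // [i j|i j k l nij nkl]; first by rewrite -!normE (eq_norm i j).
have nz_norm x : cnorm (col x Phi) != 0.
  by apply: contraNneq (nz_col x) => Nx; apply/eqP/star_dot_eq0; rewrite -normE Nx expr0n.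
have norm_real x : conj (cnorm (col x Phi)) = cnorm (col x Phi).
  apply/CrealP/ger0_real; rewrite sqrtC_ge0 sumr_ge0 // => m _.
  by rewrite mulrC mul_conjC_ge0.
(* All columns share the norm of column [i], so undoing the rescaling multiplies by its fourth
   power. *)
have gramE x y : x != y ->
    gram x y * gram y x = b%:C%C * cnorm (col i Phi) ^+ 4.
  move=> nxy; rewrite -(eq_angle x y nxy) normCK.
  set N := cnorm (col i Phi); have NJ : conj N = N by apply: norm_real.
  have -> : star_dot conj (unit_rescaling (col x Phi)) (unit_rescaling (col y Phi))
      = N^-1 ^+ 2 * gram x y.
    rewrite /star_dot mulr_sumr; apply: eq_bigr => m _.
    rewrite /unit_rescaling !(eq_norm _ i) -/N !mxE rmorphM fmorphV /= NJ.
    by ring.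
  rewrite !rmorphM !fmorphV /= NJ star_dot_morph; last exact: conjCK.
  by field; apply: nz_norm.
by rewrite !gramE.
Qed.

End ComplexGram.

(** * Transfer of the frame identities *)

Section Transfer.
Variables (R : realType) (E : splittingFieldType rat).
Variables (iota : {rmorphism E -> R[i]%C}) (d n : nat) (Phi : 'M[int_ring E]_(d, n)).
Hypothesis etfPhi : complex_etf (map_mx (int_embed iota) Phi).
Local Notation gram i j := (star_dot (int_conj iota) (col i Phi) (col j Phi)).

Lemma int_embed_zmod : zmod_morphism (int_embed iota).
Proof. by move=> a b; rewrite /int_embed !rmorphB. Qed.

Lemma int_embed_monoid : monoid_morphism (int_embed iota).
Proof. by split=> [|a b]; rewrite /int_embed ?rmorph1 ?rmorphM. Qed.

HB.instance Definition _ := GRing.isZmodMorphism.Build (int_ring E) R[i]%C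
  (int_embed iota) int_embed_zmod.
HB.instance Definition _ := GRing.isMonoidMorphism.Build (int_ring E) R[i]%C
  (int_embed iota) int_embed_monoid.

Lemma int_etf_gram :
  [/\ exists c : int_ring E, [/\ c != 0, int_conj iota c = c
        & Phi *m star_adj (int_conj iota) Phi = c%:M],
      forall i j, gram i i = gram j j
    & forall i j k l, i != j -> k != l ->
        gram i j * gram j i = gram k l * gram l k].
Proof.
have star_embed : star_preserving (int_conj iota) Num.conj (int_embed iota).
  exact: int_conjE.
have [[c c_gt0 frame] eq_norm eq_angle] := complex_etf_gram etfPhi.
have gramE i j : star_dot Num.conj (col i (map_mx (int_embed iota) Phi))
    (col j (map_mx (int_embed iota) Phi)) = int_embed iota (gram i j).
  by rewrite -!map_col (star_dot_map _ _ star_embed).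
split=> [|i j|i j k l nij nkl].
(* For [d = 0] there is no entry to read the constant from, and 1 works vacuously. *)
- have [d0|d_gt0] := posnP d.
    exists 1; split; [exact: oner_neq0 | exact: rmorph1 |].
    by apply/matrixP => i; have := ltn_ord i; rewrite {2}d0.
  pose i0 := Ordinal d_gt0.
  rewrite (star_adj_map _ star_embed) -map_mxM in frame.
  (* The frame constant is only known to be real; as a diagonal entry of the product it lies in
     [int_ring]. *)
  pose c' := (Phi *m star_adj (int_conj iota) Phi) i0 i0.
  have embed_c' : int_embed iota c' = c%:C%C.
    by have /matrixP/(_ i0 i0) := frame; rewrite mxE [RHS]mxE eqxx.
  exists c'; split.
  - apply: contraTneq c_gt0 => c'0; move: embed_c'; rewrite c'0 rmorph0 => -[<-].
    by rewrite ltxx.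
  - by apply: (@int_embed_inj _ _ iota); rewrite int_conjE embed_c' conjC_complex /= oppr0.
  apply/matrixP => i j; apply: (@int_embed_inj _ _ iota).
  have /matrixP/(_ i j) := frame; rewrite [LHS]mxE => ->.
  by rewrite !mxE -embed_c'; case: eqP => _; rewrite ?mulr0n ?mulr1n ?rmorph0.
- by apply: (@int_embed_inj _ _ iota); rewrite -!gramE.
by apply: (@int_embed_inj _ _ iota); rewrite !rmorphM /= -!gramE (eq_angle i j k l).
Qed.

Lemma star_hom_finite_etf (F : finFieldType) (p : nat)
    (f : {rmorphism int_ring E -> F}) (c : int_ring E) :
    p \in [pchar F] -> #|F| = (p ^ 2)%N ->
    star_preserving (int_conj iota) (@qpow F p) f ->
    int_conj iota c = c -> Phi *m star_adj (int_conj iota) Phi = c%:M -> f c != 0 ->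
  finite_etf p (map_mx f Phi).
Proof.
move=> charF cardF fs cJ frame nzfc; have [_ eq_norm eq_angle] := int_etf_gram.
have fframe : map_mx f Phi *m star_adj (@qpow F p) (map_mx f Phi) = (f c)%:M.
  by rewrite (star_adj_map _ fs) -map_mxM frame map_scalar_mx.
have gramE i j : star_dot (@qpow F p) (col i (map_mx f Phi)) (col j (map_mx f Phi))
    = f (gram i j).
  by rewrite -!map_col (star_dot_map _ _ fs).
have gramJ i j : qpow p (f (gram i j)) = f (gram j i).
  by rewrite -fs star_dot_morph //; apply: int_conjK.
have p_gt0 := prime_gt0 (pcharf_prime charF).
have Fq0 : in_Fq p (0 : F) by rewrite /in_Fq /qpow expr0n gtn_eqF.
split; first exact: span_columns nzfc fframe.
(* The default 0 occurs only when there is no column, or below no pair of distinct columns. *)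
pose a := if [pick j : 'I_n] is Some j then f (gram j j) else 0.
pose b := if [pick ij : 'I_n * 'I_n | ij.1 != ij.2] is Some ij
  then f (gram ij.1 ij.2) * f (gram ij.2 ij.1) else 0.
exists a, b, (f c); split=> //; first split.
- by rewrite /a; case: pickP => [j _|_] //; apply: gramJ.
(* The [p]-th power map swaps the two factors of [b]. *)
- rewrite /b; case: pickP => [[i j] /= _|_] //.
  by rewrite /in_Fq /qpow exprMn -!/(qpow p _) !gramJ mulrC.
- by rewrite /in_Fq -fs cJ.
- by move=> j; rewrite gramE /a; case: pickP => [k _|/(_ j)//]; rewrite (eq_norm j k).
move=> i j nij; rewrite !gramE /b; case: pickP => [[k l] /= nkl|/(_ (i, j))].
  by rewrite -!rmorphM (eq_angle i j k l).
by rewrite /= nij.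
Qed.
End Transfer.

(** * Infinitely many primes *)

Lemma intr_eq0_pchar (F : fieldType) (p : nat) (z : int) :
  p \in [pchar F] -> (z%:~R == 0 :> F) = (p %| `|z|)%N.
Proof.
move=> charF; case: z => n; first by rewrite -pmulrn (dvdn_pcharf charF).
by rewrite NegzE mulrNz oppr_eq0 -pmulrn (dvdn_pcharf charF).
Qed.

Lemma int_ring_divides_int (E : fieldExtType rat) (c : int_ring E) : c != 0 ->
  exists b : int_ring E, exists2 M : int, M != 0 & c * b = M%:~R.
Proof.
move=> nzc; have [|b Ob [M nzM DM]] := alg_integer_divides_int (int_valP c).
  by apply: contraNneq nzc => c0; apply/eqP/val_inj.
exists (IntRing Ob), M => //; apply: val_inj; rewrite rmorphM rmorph_int.
exact: DM.
Qed.

(** Euclid's argument: a finite [Q] is defeated by the product of its primes. Filtering the list by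
    primality keeps that product positive. *)
Lemma infinite_prime_set (Q : set nat) : (forall q, Q q -> prime q) ->
  (forall P, (0 < P)%N -> exists2 q, Q q & ~~ (q %| P)%N) -> infinite_set Q.
Proof.
move=> Q_pr Q_new /finite_seqP[s Qs].
have [|q Qq] := Q_new (\prod_(r <- s | prime r) r)%N.
  by apply: prodn_cond_gt0 => r; apply: prime_gt0.
have sq : q \in s by move: Qq; rewrite Qs.
by rewrite (big_rem q) //= (Q_pr q Qq) dvdn_mulr.
Qed.

Lemma etf_prime (R : realType) (E : splittingFieldType rat)
    (iota : {rmorphism E -> R[i]%C}) (d n : nat) (Phi : 'M[int_ring E]_(d, n))
    (P : nat) :
    galois 1%AS {:E}%AS -> complex_etf (map_mx (int_embed iota) Phi) ->
    (0 < P)%N ->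
  exists p, [/\ prime p, ~~ (p %| P)%N &
    forall F : finFieldType, #|F| = (p ^ 2)%N ->
      exists f : {rmorphism int_ring E -> F},
        star_preserving (int_conj iota) (@qpow F p) f /\
        finite_etf p (map_mx f Phi)].
Proof.
move=> galE etfPhi P_gt0.
have [eta [G [D [Geta G'eta G_dv nzD gaussian]]]] := alg_integer_gaussian iota galE.
have [[c [nzc cJ frame]] _ _] := int_etf_gram etfPhi.
have [b [M nzM DM]] := int_ring_divides_int nzc.
(* Avoiding [P] makes [p] new, avoiding [D] makes the reduction defined, and avoiding [M], a
   multiple of the frame constant [c], keeps [f c] nonzero. *)
have [|p [p_pr p3 pPDM root_p]] :=
    @simple_root_prime R G eta (P * (`|D| * `|M|)) Geta G'eta.
  by rewrite !muln_gt0 P_gt0 !absz_gt0 nzD.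
move: pPDM; rewrite !Euclid_dvdM // !negb_or => /and3P[pP pD pM].
exists p; split=> // F cardF.
have [charF [w w2 wp]] := sqrtN1_finField p_pr p3 cardF.
have [t tp Gt] := root_p F charF.
have nzDF : D%:~R != 0 :> F by rewrite (intr_eq0_pchar _ charF).
have [f fs] := gaussian_star_hom G_dv gaussian charF nzDF tp Gt w2 wp.
exists f; split=> //; apply: (star_hom_finite_etf etfPhi charF cardF fs cJ frame).
have : f (c * b) != 0 by rewrite DM rmorph_int (intr_eq0_pchar _ charF).
by rewrite rmorphM mulf_eq0 negb_or => /andP[].
Qed.

Theorem theorem7p5 (R : realType) (E : splittingFieldType rat)
    (iota : {rmorphism E -> R[i]%C}) (galE : galois 1%AS {:E}%AS)
    (d n : nat) (Phi : 'M[int_ring E]_(d, n))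
    (etfPhi : complex_etf (map_mx (int_embed iota) Phi)) :
  exists Q : set nat,
    [/\ infinite_set Q,
        forall q, Q q -> prime_power q,
        forall q1 q2, Q q1 -> Q q2 -> q1 <> q2 -> coprime q1 q2
      & forall q, Q q -> forall F : finFieldType, #|F| = (q ^ 2)%N ->
          exists f : {rmorphism int_ring E -> F},
            star_preserving (int_conj iota) (@qpow F q) f /\
            finite_etf q (map_mx f Phi)].
Proof.
pose hom q := forall F : finFieldType, #|F| = (q ^ 2)%N ->
  exists f : {rmorphism int_ring E -> F},
    star_preserving (int_conj iota) (@qpow F q) f /\ finite_etf q (map_mx f Phi).
exists [set q | prime q /\ hom q]%classic; split.
- apply: infinite_prime_set => [q []//|P P_gt0].
  have [p [p_pr pP hom_p]] := etf_prime galE etfPhi P_gt0.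
  by exists p.
- by move=> q [q_pr _]; exists q, 1%N; rewrite expn1.
- move=> q1 q2 [q1_pr _] [q2_pr _] /eqP neq.
  by rewrite prime_coprime // dvdn_prime2.
by move=> q [].
Qed.
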